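(* Let $X$, $Y$, $Z$ be related by the structural equations $$X=\sum_{i=1}^m I(Z=z_i)\,V_i,\qquad Y=\sum_{j=0}^n I(X=x_j)\,U_j .$$ Suppose $Z$ is independent of the collection $\{V_1,\dots,V_m;U_0,U_1,\dots,U_n\}$ and that there exists $S_0\subset S$ such that (i) $\Delta_{j0}Y$ and $\Delta_{ik}I_j(X)$ have zero correlation, for all $\{i,k\}\in S_0$ and all $j\in\{1,\dots,n\}$; (ii) $\operatorname{rank}(A)\ge n$, where $A$ is the matrix $(a_{sj})_{s\in S_0,\ j=1,\dots,n}$. Then the vector of causal effects $\theta=(\theta_1,\dots,\theta_n)$, $\theta_j=E(U_j-U_0)$, is identifiable from the joint distribution of $(X,Y,Z)$ via the equation $A\theta=b$, where $b=(b_s)_{s\in S_0}$; that is, $\theta$ satisfies $A\theta=b$ and is the unique vector in $\mathbb{R}^n$ that does so, while $A$ and $b$ are determined by the joint distribution of $(X,Y,Z)$.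
   Context: All random variables are defined on a probability space $(\Omega,\mathcal{A},P)$. $Z$ takes values in a finite set $\{z_1,\dots,z_m\}$ of distinct points, each with positive probability; $X$ and $V_1,\dots,V_m$ take values in a finite set $\{x_0,x_1,\dots,x_n\}$ of distinct points; $U_0,\dots,U_n$ (hence $Y$) are real-valued and integrable. The first structural equation means $X=V_i$ on the event $\{Z=z_i\}$, and the second means $Y=U_j$ on $\{X=x_j\}$. No restriction is imposed on the joint distribution of the $U_j$'s and $V_i$'s beyond those in the claim. $I(\cdot)$ denotes the indicator of an event. Notation: - $\Delta_{j0}Y=U_j-U_0$ (change in $Y$ when $X$ changes from $x_0$ to $x_j$). - $\Delta_{ik}I_j(X)=I(V_i=x_j)-I(V_k=x_j)$ (change in $I(X=x_j)$ when $Z$ changes from $z_k$ to $z_i$). - $S$ is the set of unordered pairs $\{i,k\}$ of distinct indices from $\{1,\dots,m\}$. For each $s=\{i,k\}\in S$ fix one ordering $(i,k)$ of the pair (the choice only affects signs, consistently in the following two definitions) and put $$b_s=E(Y\mid Z=z_i)-E(Y\mid Z=z_k),\qquad a_{sj}=P(X=x_j\mid Z=z_i)-P(X=x_j\mid Z=z_k),\quad j=1,\dots,n.$$ - Two variables $B,C$ have zero correlation if $E(BC)=E(B)E(C)$. *)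

(* Defs.v *)
From HB Require Import structures.
From mathcomp Require Export all_boot all_order all_algebra.
From mathcomp Require Export all_classical all_reals all_analysis.

Set Implicit Arguments.
Unset Strict Implicit.
Unset Printing Implicit Defensive.

Import Order.TTheory GRing.Theory Num.Theory.
Import numFieldNormedType.Exports.

Local Open Scope classical_set_scope.
Local Open Scope ring_scope.

Section Probability.
Context (d : measure_display) (T : measurableType d) (R : realType).
Variable P : probability T R.

Definition independent_classes (G H : set (set T)) : Prop :=
  forall A B, G A -> H B -> P (A `&` B) = (P A * P B)%E.

(* Independence of one random element from two families taken jointly, so
   that nothing is imposed on the dependence inside the families. *)
Definition independent_of_collection (dZ dV dU : measure_display)
    (TZ : measurableType dZ) (TV : measurableType dV) (TU : measurableType dU)
    (p q : nat)
    (Z : T -> TZ) (V : 'I_p -> T -> TV) (U : 'I_q -> T -> TU) : Prop :=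
  independent_classes (preimage_set_system setT Z measurable)
    <<s g_sigma_preimage V `|` g_sigma_preimage U >>.

(* Elementary conditioning: meaningful only when [P F] is positive. *)
Definition cond_prob (E F : set T) : R := fine (P (E `&` F)) / fine (P F).

Definition cond_expectation (Y : T -> R) (F : set T) : R :=
  (\int[P]_(w in F) Y w) / fine (P F).

Definition zero_correlation (B C : T -> R) : Prop :=
  ('E_P[(fun w => B w * C w)%R] = 'E_P[B] * 'E_P[C])%E.

Definition joint_law (dX dY dZ : measure_display)
    (TX : measurableType dX) (TY : measurableType dY) (TZ : measurableType dZ)
    (X : T -> TX) (Y : T -> TY) (Z : T -> TZ) :
    set (TX * TY * TZ) -> \bar R :=
  pushforward P (fun w => (X w, Y w, Z w)).

End Probability.

Definition takes_values_in (T S I : Type) (X : T -> S) (x : I -> S) : Prop :=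
  forall w, exists i, X w = x i.

Definition unordered_pairs (m : nat) : {set {set 'I_m}} :=
  [set s : {set 'I_m} | #|s| == 2%N].

(* [o s] is the chosen ordering (i, k) of the pair s = {i, k}. *)
Definition ordering_of_pairs (m : nat) (o : {set 'I_m} -> 'I_m * 'I_m) : Prop :=
  forall s, s \in unordered_pairs m -> s = [set (o s).1; (o s).2]%SET.

Section CausalModel.
Context (d dX dZ : measure_display) (T : measurableType d)
  (TX : measurableType dX) (TZ : measurableType dZ) (R : realType).
Variables (P : probability T R) (m n : nat).

Definition DeltaY (U : 'I_n.+1 -> T -> R) (j : 'I_n.+1) : T -> R :=
  fun w => U j w - U ord0 w.

Definition DeltaI (V : 'I_m -> T -> TX) (x : 'I_n.+1 -> TX)
    (i k : 'I_m) (j : 'I_n.+1) : T -> R :=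
  fun w => \1_(V i @^-1` [set x j]) w - \1_(V k @^-1` [set x j]) w.

(* Coordinate j : 'I_n stands for the index j + 1, that is [lift ord0 j]. *)
Definition causal_effects (U : 'I_n.+1 -> T -> R) : 'cV[R]_n :=
  \col_j fine 'E_P[DeltaY U (lift ord0 j)].

Section Coefficients.
Variables (x : 'I_n.+1 -> TX) (z : 'I_m -> TZ).
Variables (o : {set 'I_m} -> 'I_m * 'I_m) (S0 : {set {set 'I_m}}).
Variables (X : T -> TX) (Y : T -> R) (Z : T -> TZ).

(* The rows are indexed by the elements of S0 in their enumeration order. *)
Definition coefA : 'M[R]_(#|S0|, n) :=
  \matrix_(r, j)
    let: (i, k) := o (enum_val r) in
    let E := X @^-1` [set x (lift ord0 j)] in
    cond_prob P E (Z @^-1` [set z i]) - cond_prob P E (Z @^-1` [set z k]).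

Definition coefb : 'cV[R]_(#|S0|) :=
  \col_r
    let: (i, k) := o (enum_val r) in
    cond_expectation P Y (Z @^-1` [set z i]) -
    cond_expectation P Y (Z @^-1` [set z k]).

End Coefficients.
End CausalModel.

(* Main.v *)
(* On {Z = z_i} the outcome Y equals W_i = sum_j I(V_i = x_j) U_j, which is a
   function of (V, U) only; independence of Z turns conditioning on
   {Z = z_i} into plain expectation: E(Y | Z = z_i) = E(W_i) and
   P(X = x_j | Z = z_i) = P(V_i = x_j).  Since sum_j (I(V_i = x_j) - I(V_k = x_j))
   vanishes, U_0 can be subtracted from every U_j in W_i - W_k, so that
   W_i - W_k = sum_(j >= 1) (U_j - U_0) (I(V_i = x_j) - I(V_k = x_j)), and zero
   correlation factors the expectation of each term: this is A theta = b.
   Full column rank of A gives uniqueness. *)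

Require Import Defs.
From HB Require Import structures.
From mathcomp Require Import all_boot all_order all_algebra.
From mathcomp Require Import all_classical all_reals all_analysis.
From mathcomp Require Import measurable_realfun.

Set Implicit Arguments.
Unset Strict Implicit.
Unset Printing Implicit Defensive.

Import Order.TTheory GRing.Theory Num.Theory.
Import numFieldNormedType.Exports.

Local Open Scope classical_set_scope.
Local Open Scope ring_scope.

(** * Factoring an integral over an independent event *)

Section FactorizationOverEvents.
Context (d d2 : measure_display) (T : measurableType d)
  (T2 : measurableType d2) (R : realType) (P : probability T R).
Variables (F : set T) (W : T -> T2).
Hypotheses (mF : measurable F) (mW : measurable_fun setT W).
Hypothesis FW_indep : forall B, measurable B ->
  (P (F `&` W @^-1` B) = P F * P (W @^-1` B))%E.

(* Both sides are integrals of [f] against the image under [W] of a measure on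
   [T], namely [P] restricted to [F] and [P F] times [P]; independence says that
   these images coincide. *)
Lemma ge0_integral_indep (f : T2 -> \bar R) :
  measurable_fun setT f -> (forall y, (0 <= f y)%E) ->
  (\int[P]_(w in F) f (W w) = P F * \int[P]_w f (W w))%E.
Proof.
move=> mf f0; have mfW : measurable_fun setT (f \o W) by exact: measurableT_comp.
have PF0 : 0 <= fine (P F) by rewrite fine_ge0.
have PFfin : P F \is a fin_num by rewrite fin_num_measure.
pose k : {nonneg R} := NngNum PF0.
(* Restricting [P] to [F] keeps the measure of subsets of [F] and makes the complement of [F] null,
   so the domain can grow to the whole space, where the change of variables applies. *)
rewrite (@eq_measure_integral _ _ _ F (mrestr P mF)); last first.
  by move=> A mA AF; rewrite /= /mrestr setIidl.
have -> : (\int[mrestr P mF]_(w in F) f (W w) =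
           \int[mrestr P mF]_w f (W w))%E.
  rewrite [RHS](@ge0_negligible_integral _ _ _ _ setT (~` F))//.
  - by rewrite setTD setCK.
  - exact: measurableC.
  - by rewrite /= /mrestr setICl measure0.
have nz y : y \in [set: T2] -> (0 <= f y)%E by [].
rewrite -(ge0_integral_pushforward mW (mrestr P mF) measurableT mf nz).
(* [k] is P(F) packaged as a nonnegative real, the form of scalar that [mscale] takes. *)
rewrite (eq_measure_integral (mscale k (pushforward P W))); last first.
  move=> B mB _; rewrite /= /mscale /pushforward /mrestr setIC FW_indep//.
  by rewrite fineK.
rewrite ge0_integral_mscale// ge0_integral_pushforward//=.
by rewrite fineK.
Qed.

End FactorizationOverEvents.

(** The positive and negative parts of [W] are nonnegative functions of [W], so the previous lemma
    applies to each. *)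
Lemma Rintegral_indep (d : measure_display) (T : measurableType d)
    (R : realType) (P : probability T R) (F : set T) (W : T -> R) :
  measurable F -> P.-integrable setT (EFin \o W) ->
  (forall B, measurable B ->
    (P (F `&` W @^-1` B) = P F * P (W @^-1` B))%E) ->
  \int[P]_(w in F) W w = fine (P F) * \int[P]_w W w.
Proof.
move=> mF iW FW.
have mW : measurable_fun setT W.
  by apply/measurable_EFinP; exact: measurable_int iW.
have PFfin : P F \is a fin_num by rewrite fin_num_measure.
rewrite /Rintegral -fineM//; last exact: integrable_fin_num.
congr fine; rewrite [LHS]integralE [X in (_ * X)%E]integralE.
rewrite !(funepos_comp (@EFin (Real.sort R)) W)
  !(funeneg_comp (@EFin (Real.sort R)) W).
rewrite (ge0_integral_indep mF mW FW)//; last exact: measurable_funepos.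
rewrite (ge0_integral_indep mF mW FW)//; last exact: measurable_funeneg.
(* Pulling P(F) out of the difference requires that it is not of the form oo - oo, which
   integrability of [W] guarantees. *)
rewrite -muleBr//; have := integrable_add_def measurableT iW.
by rewrite (funepos_comp (@EFin (Real.sort R)) W)
  (funeneg_comp (@EFin (Real.sort R)) W).
Qed.

(** * Quantities determined by the joint law of (X, Y, Z) *)

Section JointLaw.
Context (dX dZ d d' : measure_display)
  (TX : measurableType dX) (TZ : measurableType dZ)
  (T : measurableType d) (T' : measurableType d') (R : realType)
  (P : probability T R) (P' : probability T' R).
Variables (X : {RV P >-> TX}) (Y : {RV P >-> R}) (Z : {RV P >-> TZ}).
Variables (X' : {RV P' >-> TX}) (Y' : {RV P' >-> R}) (Z' : {RV P' >-> TZ}).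
Hypothesis same_law : forall C, measurable C ->
  joint_law P' X' Y' Z' C = joint_law P X Y Z C.

Lemma eq_law_prob (D : set TZ) : measurable D ->
  P' (Z' @^-1` D) = P (Z @^-1` D).
Proof.
move=> mD; have := same_law (measurableX (@measurableT _ (TX * R)%type) mD).
(* The event is the preimage of a cylinder. The identity is stated over an arbitrary [S] so that it
   rewrites both probability spaces. *)
suff pre (S : Type) (f : S -> TX * R) (g : S -> TZ) :
  (fun w => (f w, g w)) @^-1` (setT `*` D) = g @^-1` D.
  by rewrite /joint_law /pushforward !pre.
by apply/seteqP; split=> w //= [].
Qed.

Lemma eq_law_cond_prob (C : set TX) (D : set TZ) :
  measurable C -> measurable D ->
  cond_prob P' (X' @^-1` C) (Z' @^-1` D) = cond_prob P (X @^-1` C) (Z @^-1` D).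
Proof.
move=> mC mD; rewrite /cond_prob eq_law_prob//; congr (fine _ / _).
have := same_law (measurableX (measurableX mC (@measurableT _ R)) mD).
suff pre (S : Type) (f : S -> TX) (g : S -> R) (h : S -> TZ) :
  (fun w => (f w, g w, h w)) @^-1` (C `*` setT `*` D) = f @^-1` C `&` h @^-1` D.
  by rewrite /joint_law /pushforward !pre.
by apply/seteqP; split=> w //= [] // [].
Qed.

(** For nonnegative [f], the integral of f(Y) over {Z in D} is an integral against the joint law
    over a cylinder; taking for [f] the positive and negative parts of the identity gives the claim
    for [Y]. *)
Lemma eq_law_cond_expectation (D : set TZ) : measurable D ->
  cond_expectation P' Y' (Z' @^-1` D) = cond_expectation P Y (Z @^-1` D).
Proof.
move=> mD; rewrite /cond_expectation eq_law_prob//; congr (_ / _).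
pose XYZ w := (X w, Y w, Z w); pose XYZ' w := (X' w, Y' w, Z' w).
have mXYZ : measurable_fun setT XYZ.
  by apply: measurable_fun_pair; first exact: measurable_fun_pair.
have mXYZ' : measurable_fun setT XYZ'.
  by apply: measurable_fun_pair; first exact: measurable_fun_pair.
pose E : set (TX * R * TZ) := setT `*` D.
have mE : measurable E by exact: measurableX.
have eq_ge0 (f : R -> \bar R) : measurable_fun setT f ->
    (forall y, (0 <= f y)%E) ->
    (\int[P']_(w in Z' @^-1` D) f (Y' w) = \int[P]_(w in Z @^-1` D) f (Y w))%E.
  move=> mf f0; pose g (p : TX * R * TZ) := f p.1.2.
  have mg : measurable_fun E g.
    apply: measurable_funTS; apply: (measurableT_comp mf).
    exact: (measurableT_comp measurable_snd measurable_fst).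
  have g0 p : p \in E -> (0 <= g p)%E by move=> _; exact: f0.
  have -> : Z @^-1` D = XYZ @^-1` E by apply/seteqP; split=> w //= [].
  have -> : Z' @^-1` D = XYZ' @^-1` E by apply/seteqP; split=> w //= [].
  rewrite -(ge0_integral_pushforward mXYZ P mE mg g0).
  rewrite -(ge0_integral_pushforward mXYZ' P' mE mg g0).
  by apply: eq_measure_integral => A mA _; exact: same_law.
rewrite /Rintegral; congr fine; rewrite [LHS]integralE [RHS]integralE.
rewrite !(funepos_comp (@EFin (Real.sort R)) Y)
  !(funeneg_comp (@EFin (Real.sort R)) Y).
rewrite !(funepos_comp (@EFin (Real.sort R)) Y')
  !(funeneg_comp (@EFin (Real.sort R)) Y').
by congr (_ - _)%E; apply: eq_ge0 => //;
  [exact: measurable_funepos|exact: measurable_funeneg].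
Qed.

End JointLaw.

(** * Auxiliary facts on generated sigma-algebras and integrals *)

Lemma g_sigma_preimage_sub (d : measure_display) (T : Type)
    (S : measurableType d) (n : nat) (f : 'I_n -> T -> S) (i : 'I_n)
    (B : set S) :
  measurable B -> g_sigma_preimage f (f i @^-1` B).
Proof.
move=> mB; apply: sub_sigma_algebra; rewrite (bigD1 i)//=.
by left; exists B => //; rewrite setTI.
Qed.

Lemma integrable_indicM (d : measure_display) (T : measurableType d)
    (R : realType) (mu : {measure set T -> \bar R}) (E : set T) (f : T -> R) :
  measurable E -> mu.-integrable setT (EFin \o f) ->
  mu.-integrable setT (EFin \o (fun w => \1_E w * f w)).
Proof.
move=> mE fi.
(* The indicator is the bounded factor, with bound 1. *)
apply: (@integrableMr _ _ _ mu setT measurableT \1_E (EFin \o f)) => //.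
exists 1; split=> // M M1 w _ /=.
by rewrite indicE ger0_norm// (le_trans _ (ltW M1))// lern1 leq_b1.
Qed.

Lemma Rintegral_sum (d : measure_display) (T : measurableType d)
    (R : realType) (mu : {measure set T -> \bar R})
    (I : Type) (s : seq I) (f : I -> T -> R) :
  (forall j, mu.-integrable setT (EFin \o f j)) ->
  \int[mu]_w (\sum_(j <- s) f j w) = \sum_(j <- s) \int[mu]_w f j w.
Proof.
move=> fi; rewrite /Rintegral; under eq_integral do rewrite -sumEFin.
rewrite integral_sum// sum_fine// => j _.
exact: (integrable_fin_num measurableT (fi j)).
Qed.

Lemma fine_expectation (d : measure_display) (T : measurableType d)
    (R : realType) (P : probability T R) (W : T -> R) :
  fine 'E_P[W]%E = \int[P]_w W w.
Proof. by rewrite unlock. Qed.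

(** Zero correlation is an identity of extended reals; integrability makes both expectations finite,
    so [fine] commutes with their product. *)
Lemma zero_correlation_Rintegral (d : measure_display) (T : measurableType d)
    (R : realType) (P : probability T R) (B C : T -> R) :
  P.-integrable setT (EFin \o B) -> P.-integrable setT (EFin \o C) ->
  zero_correlation P B C ->
  \int[P]_w (B w * C w) = (\int[P]_w B w) * \int[P]_w C w.
Proof.
move=> iB iC /(congr1 fine); rewrite fine_expectation => ->.
by rewrite fineM ?fine_expectation// unlock integrable_fin_num.
Qed.

(** * The causal model and one row of the linear system *)

Section CausalEffects.
Context (d dX dZ : measure_display) (T : measurableType d)
  (TX : measurableType dX) (TZ : measurableType dZ) (R : realType).
Variables (P : probability T R) (m n : nat).
Variables (x : 'I_n.+1 -> TX) (z : 'I_m -> TZ).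
Variables (X : {RV P >-> TX}) (Y : {RV P >-> R}) (Z : {RV P >-> TZ}).
Variables (V : 'I_m -> {RV P >-> TX}) (U : 'I_n.+1 -> {RV P >-> R}).
Hypotheses (x_inj : injective x) (x_meas : forall j, measurable [set x j]).
Hypothesis z_meas : forall i, measurable [set z i].
Hypothesis Z_pos : forall i, (0 < P (Z @^-1` [set z i]))%E.
Hypothesis V_values : forall i, takes_values_in (V i) x.
Hypothesis U_integrable : forall j, P.-integrable setT (fun w => (U j w)%:E).
Hypothesis X_eq : forall i w, Z w = z i -> X w = V i w.
Hypothesis Y_eq : forall w,
  Y w = \sum_(j < n.+1) \1_(X @^-1` [set x j]) w * U j w.
Hypothesis Z_indep : independent_of_collection P Z
  (fun i => V i : T -> TX) (fun j => U j : T -> R).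

Let VU : set (set T) :=
  g_sigma_preimage (fun i => V i : T -> TX) `|`
  g_sigma_preimage (fun j => U j : T -> R).

(* The value [Y] would take if [Z] were set to [z i]. *)
Definition potential_outcome (i : 'I_m) (w : T) : R :=
  \sum_(j < n.+1) \1_(V i @^-1` [set x j]) w * U j w.

Lemma measurable_preimage_value (i : 'I_m) (j : 'I_n.+1) :
  measurable (V i @^-1` [set x j]).
Proof. by rewrite -[_ @^-1` _]setTI; exact: measurable_funP. Qed.

Lemma measurable_preimage_instrument (i : 'I_m) :
  measurable (Z @^-1` [set z i]).
Proof. by rewrite -[_ @^-1` _]setTI; exact: measurable_funP. Qed.

Lemma instrument_indep (i : 'I_m) (E : set T) : <<s VU >> E ->
  P (Z @^-1` [set z i] `&` E) = (P (Z @^-1` [set z i]) * P E)%E.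
Proof.
move=> mE; apply: Z_indep => //.
by exists [set z i] => //; rewrite setTI.
Qed.

Lemma preimage_value_VU (i : 'I_m) (j : 'I_n.+1) :
  <<s VU >> (V i @^-1` [set x j]).
Proof.
apply: sub_sigma_algebra; left.
exact: (@g_sigma_preimage_sub _ _ _ _ (fun i => V i : T -> TX)).
Qed.

(** Equipping [T] with the sigma-algebra generated by [VU] turns the claim into measurability of a
    finite sum of products, each factor being measurable for a generator. *)
Lemma potential_outcome_VU (i : 'I_m) (B : set R) : measurable B ->
  <<s VU >> (potential_outcome i @^-1` B).
Proof.
move=> mB.
have mW : @measurable_fun _ _ (g_sigma_algebraType VU) R setT
    (potential_outcome i).
  apply: measurable_sum => j; apply: measurable_funM.
    by apply: measurable_indic; exact: preimage_value_VU.
  move=> _ C mC; rewrite setTI; apply: sub_sigma_algebra; right.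
  exact: (@g_sigma_preimage_sub _ _ _ _ (fun j => U j : T -> R)).
by have := mW measurableT B mB; rewrite setTI.
Qed.

Lemma integrable_potential_outcome (i : 'I_m) :
  P.-integrable setT (EFin \o potential_outcome i).
Proof.
have -> : EFin \o potential_outcome i =
    fun w => (\sum_(j < n.+1) (\1_(V i @^-1` [set x j]) w * U j w)%:E)%E.
  by apply/funext => w; rewrite /= sumEFin.
apply: integrable_sum => // j _.
apply: integrable_indicM; first exact: measurable_preimage_value.
exact: U_integrable.
Qed.

Lemma fine_instrument_neq0 (i : 'I_m) : fine (P (Z @^-1` [set z i])) != 0.
Proof.
rewrite gt_eqF// fine_gt0// Z_pos/= ltey_eq fin_num_measure//.
exact: measurable_preimage_instrument.
Qed.

Lemma cond_prob_value (i : 'I_m) (j : 'I_n.+1) :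
  cond_prob P (X @^-1` [set x j]) (Z @^-1` [set z i]) =
  fine (P (V i @^-1` [set x j])).
Proof.
rewrite /cond_prob.
have -> : X @^-1` [set x j] `&` Z @^-1` [set z i] =
          Z @^-1` [set z i] `&` V i @^-1` [set x j].
  by apply/seteqP; split=> w /= [] => [+ Zi|Zi +]; rewrite (X_eq Zi).
rewrite instrument_indep; last exact: preimage_value_VU.
rewrite fineM ?fin_num_measure//; last 2 first.
- exact: measurable_preimage_instrument.
- exact: measurable_preimage_value.
by rewrite mulrAC divff ?mul1r// fine_instrument_neq0.
Qed.

Lemma cond_expectation_outcome (i : 'I_m) :
  cond_expectation P Y (Z @^-1` [set z i]) = \int[P]_w potential_outcome i w.
Proof.
rewrite /cond_expectation.
(* On {Z = z_i} the indicators of X = x_j and V_i = x_j agree, so [Y] is the potential outcome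
   there. *)
rewrite (@eq_Rintegral _ _ _ _ _ (potential_outcome i)); last first.
  move=> w /[!inE]/= Zi; rewrite Y_eq; apply: eq_bigr => j _.
  rewrite !indicE; congr ((nat_of_bool _)%:R * _).
  by apply/idP/idP; rewrite !inE/= (X_eq Zi).
rewrite Rintegral_indep.
- by rewrite mulrAC divff ?mul1r// fine_instrument_neq0.
- exact: measurable_preimage_instrument.
- exact: integrable_potential_outcome.
- by move=> B mB; apply: instrument_indep; exact: potential_outcome_VU.
Qed.

(** Exactly one indicator is 1: some x_j is attained, and only one since [x] is injective. *)
Lemma sum_value_indic (i : 'I_m) (w : T) :
  \sum_(j < n.+1) \1_(V i @^-1` [set x j]) w = 1 :> R.
Proof.
have [j0 Vj0] := V_values i w.
rewrite (bigD1 j0)//= big1 => [|j jj0]; rewrite indicE.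
  by rewrite mem_set ?addr0.
by rewrite memNset//= Vj0 => /x_inj j0j; rewrite j0j eqxx in jj0.
Qed.

Lemma potential_outcomeB (i k : 'I_m) (w : T) :
  potential_outcome i w - potential_outcome k w =
  \sum_(j < n) DeltaY U (lift ord0 j) w * DeltaI R V x i k (lift ord0 j) w.
Proof.
pose D j : R := DeltaI R V x i k j w.
have D0 : \sum_(j < n.+1) D j * U ord0 w = 0.
  by rewrite -mulr_suml sumrB !sum_value_indic subrr mul0r.
(* Subtracting this vanishing sum replaces each U_j by U_j - U_0, which cancels the term j = 0. *)
rewrite -[LHS]subr0 -[X in _ - X = _]D0 /potential_outcome.
rewrite -!sumrB big_ord_recl /D /DeltaI -mulrBl subrr add0r.
by apply: eq_bigr => j _; rewrite -mulrBl -mulrBr mulrC.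
Qed.

Lemma integrable_DeltaY (j : 'I_n.+1) :
  P.-integrable setT (EFin \o DeltaY U j).
Proof.
exact: (integrableB measurableT (U_integrable j) (U_integrable ord0)).
Qed.

Lemma integrable_DeltaI (i k : 'I_m) (j : 'I_n.+1) :
  P.-integrable setT (EFin \o DeltaI R V x i k j).
Proof.
exact: (integrableB measurableT
  (integrable_indic _ (measurable_preimage_value i j))
  (integrable_indic _ (measurable_preimage_value k j))).
Qed.

(** Integrability comes from expanding the difference of indicators: each resulting term is an
    integrable function times one indicator. *)
Lemma integrable_DeltaYI (i k : 'I_m) (j : 'I_n.+1) :
  P.-integrable setT (EFin \o (fun w => DeltaY U j w * DeltaI R V x i k j w)).
Proof.
have -> : EFin \o (fun w => DeltaY U j w * DeltaI R V x i k j w) =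
    (fun w => (\1_(V i @^-1` [set x j]) w * DeltaY U j w)%:E -
              (\1_(V k @^-1` [set x j]) w * DeltaY U j w)%:E)%E.
  by apply/funext => w; rewrite /= /DeltaI mulrBr -EFinB ![DeltaY _ _ _ * _]mulrC.
exact: (integrableB measurableT
  (integrable_indicM (measurable_preimage_value i j) (integrable_DeltaY j))
  (integrable_indicM (measurable_preimage_value k j) (integrable_DeltaY j))).
Qed.

Lemma Rintegral_DeltaI (i k : 'I_m) (j : 'I_n.+1) :
  \int[P]_w DeltaI R V x i k j w =
  fine (P (V i @^-1` [set x j])) - fine (P (V k @^-1` [set x j])).
Proof.
rewrite /DeltaI RintegralB//; last 2 first.
- by apply: integrable_indic; exact: measurable_preimage_value.
- by apply: integrable_indic; exact: measurable_preimage_value.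
rewrite /Rintegral !integral_indic ?setIT//;
  exact: measurable_preimage_value.
Qed.

(** This is the row of A theta = b attached to the ordered pair (i, k). *)
Lemma cond_expectationB (i k : 'I_m) :
  (forall j : 'I_n, zero_correlation P (DeltaY U (lift ord0 j))
                                       (DeltaI R V x i k (lift ord0 j))) ->
  cond_expectation P Y (Z @^-1` [set z i]) -
  cond_expectation P Y (Z @^-1` [set z k]) =
  \sum_(j < n)
    (cond_prob P (X @^-1` [set x (lift ord0 j)]) (Z @^-1` [set z i]) -
     cond_prob P (X @^-1` [set x (lift ord0 j)]) (Z @^-1` [set z k])) *
    fine 'E_P[DeltaY U (lift ord0 j)]%E.
Proof.
move=> zc; rewrite !cond_expectation_outcome -RintegralB//; last 2 first.
- exact: integrable_potential_outcome.
- exact: integrable_potential_outcome.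
under eq_Rintegral do rewrite potential_outcomeB.
rewrite Rintegral_sum => [|j]; last exact: integrable_DeltaYI.
apply: eq_bigr => j _; rewrite !cond_prob_value -Rintegral_DeltaI.
rewrite fine_expectation mulrC; apply: zero_correlation_Rintegral => //.
- exact: integrable_DeltaY.
- exact: integrable_DeltaI.
Qed.

End CausalEffects.

(** * Identification of the causal effects *)

Theorem theorem1 (R : realType)
    (d dX dZ : measure_display) (T : measurableType d)
    (TX : measurableType dX) (TZ : measurableType dZ)
    (P : probability T R) (m n : nat)
    (x : 'I_n.+1 -> TX) (z : 'I_m -> TZ)
    (X : {RV P >-> TX}) (Y : {RV P >-> R}) (Z : {RV P >-> TZ})
    (V : 'I_m -> {RV P >-> TX}) (U : 'I_n.+1 -> {RV P >-> R})
    (o : {set 'I_m} -> 'I_m * 'I_m) (S0 : {set {set 'I_m}})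
    (x_inj : injective x) (x_meas : forall j, measurable [set x j])
    (z_inj : injective z) (z_meas : forall i, measurable [set z i])
    (Z_values : takes_values_in Z z)
    (Z_pos : forall i, (0 < P (Z @^-1` [set z i]))%E)
    (X_values : takes_values_in X x)
    (V_values : forall i, takes_values_in (V i) x)
    (U_integrable : forall j, P.-integrable setT (fun w => (U j w)%:E))
    (X_eq : forall i w, Z w = z i -> X w = V i w)
    (Y_eq : forall w,
       Y w = \sum_(j < n.+1) \1_(X @^-1` [set x j]) w * U j w)
    (Z_indep : independent_of_collection P Z
       (fun i => V i : T -> TX) (fun j => U j : T -> R))
    (o_ordering : ordering_of_pairs o)
    (S0_sub : S0 \subset unordered_pairs m)
    (zero_corr : forall (i k : 'I_m) (j : 'I_n), [set i; k]%SET \in S0 ->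
       zero_correlation P (DeltaY U (lift ord0 j))
                          (DeltaI R V x i k (lift ord0 j)))
    (rank_ge : (n <= \rank (coefA P x z o S0 X Z))%N) :
  let A := coefA P x z o S0 X Z in
  let b := coefb P z o S0 Y Z in
  let theta := causal_effects P U in
  [/\ A *m theta = b,
      forall t : 'cV[R]_n, A *m t = b -> t = theta &
      forall (d' : measure_display) (T' : measurableType d')
             (P' : probability T' R)
             (X' : {RV P' >-> TX}) (Y' : {RV P' >-> R}) (Z' : {RV P' >-> TZ}),
        (forall C, measurable C ->
           joint_law P' X' Y' Z' C = joint_law P X Y Z C) ->
        coefA P' x z o S0 X' Z' = A /\ coefb P' z o S0 Y' Z' = b].
Proof.
move=> A b theta.
have A_theta : A *m theta = b.
  apply/matrixP => r c; rewrite !mxE ord1 {c}.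
  have rS0 := enum_valP r.
  (* The chosen ordering recovers the row's pair as {i, k}, which places it in [S0] and makes zero
     correlation available. *)
  have := o_ordering _ (fintype.subsetP S0_sub _ rS0).
  under eq_bigr do rewrite !mxE.
  case: (o (enum_val r)) => i k /= sE.
  apply/esym/cond_expectationB => // j.
  by apply: zero_corr; rewrite -sE.
split=> // [t At|d' T' P' X' Y' Z' same_law].
(* [A] has n columns, so rank at least n means rank exactly n; transposing turns injectivity of [A]
   on columns into row freeness. *)
- have AT_free : row_free A^T by rewrite /row_free mxrank_tr eqn_leq rank_leq_col.
  apply: trmx_inj; apply: (row_free_inj AT_free).
  by rewrite -!trmx_mul At A_theta.
- split; apply/matrixP => r c; rewrite !mxE; case: (o _) => i k /=.
  + by rewrite !(eq_law_cond_prob same_law).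
  + by rewrite !(eq_law_cond_expectation same_law).
Qed.
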